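(* Let $\mathbb{K}$ be a field of characteristic zero, let $n\ge 1$, and let $R_0$ be the $(n+1)$-dimensional Leibniz algebra over $\mathbb{K}$ with basis $\{e_0,e_1,\dots,e_n\}$ and multiplication $$[e_i,e_1]=e_{i+1}\ (0\le i\le n-1),\qquad [e_i,e_0]=-i\,e_i\ (1\le i\le n),$$ all other products of basis elements being zero. Then every local automorphism of $R_0$ is an automorphism of $R_0$.
   Context: A Leibniz algebra over $\mathbb{K}$ is a $\mathbb{K}$-vector space $L$ with a bilinear product $[-,-]$ satisfying $[[x,y],z]=[[x,z],y]+[x,[y,z]]$ for all $x,y,z\in L$. An automorphism of an algebra $A$ is a bijective linear map $\varphi:A\to A$ with $\varphi([x,y])=[\varphi(x),\varphi(y)]$ for all $x,y\in A$. A linear map $\Phi:A\to A$ is called a local automorphism if for every $x\in A$ there exists an automorphism $\varphi_x:A\to A$ (depending on $x$) such that $\Phi(x)=\varphi_x(x)$. *)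

(* Defs.v *)
From HB Require Import structures.
From mathcomp Require Import all_boot all_order all_algebra.
From mathcomp Require Import ring.

Set Implicit Arguments.
Unset Strict Implicit.
Unset Printing Implicit Defensive.

Import GRing.Theory.
Local Open Scope ring_scope.

HB.mixin Record isLeibniz (K : fieldType) L of GRing.Lmodule K L := {
  bracket : L -> L -> L;
  bracket_linearl : forall y, linear (bracket^~ y);
  bracket_linearr : forall x, linear (bracket x);
  bracket_leibniz : forall x y z,
    bracket (bracket x y) z = bracket (bracket x z) y + bracket x (bracket y z)
}.

#[short(type="leibnizAlgType")]
HB.structure Definition Leibniz (K : fieldType) :=
  { L of GRing.Lmodule K L & isLeibniz K L }.

Definition automorphism (K : fieldType) (A : leibnizAlgType K) (f : A -> A) :
    Prop :=
  [/\ linear f, bijective f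
    & forall x y, f (bracket x y) = bracket (f x) (f y)].

Definition local_automorphism (K : fieldType) (A : leibnizAlgType K)
    (f : A -> A) : Prop :=
  linear f /\ forall x, exists2 phi : A -> A, automorphism phi & f x = phi x.

Definition R0 (K : fieldType) (n : nat) : Type := 'rV[K]_n.+1.

HB.instance Definition _ (K : fieldType) (n : nat) :=
  GRing.Lmodule.on (R0 K n).

Definition R0_basis (K : fieldType) (n : nat) (i : 'I_n.+1) : R0 K n :=
  delta_mx 0 i.

(* Product of basis elements.  The second branch also covers i = 0, where the
   coefficient vanishes; inord i.+1 is the index i + 1 because i < n. *)
Definition R0_table (K : fieldType) (n : nat) (i j : 'I_n.+1) : R0 K n :=
  if (j == 1 :> nat) && (i < n)%N then R0_basis K (inord i.+1)
  else if j == 0 :> nat then - i%:R *: R0_basis K i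
  else 0.

Definition R0_bracket (K : fieldType) (n : nat) (x y : R0 K n) : R0 K n :=
  \sum_(i < n.+1) \sum_(j < n.+1) (x 0 i * y 0 j) *: R0_table K i j.

Lemma R0_bracket_linearl (K : fieldType) (n : nat) (y : R0 K n) :
  linear ((@R0_bracket K n)^~ y).
Proof.
move=> a u v; rewrite /R0_bracket scaler_sumr -big_split /=.
apply: eq_bigr => i _; rewrite scaler_sumr -big_split /=.
by apply: eq_bigr => j _; rewrite !mxE mulrDl scalerDl -mulrA scalerA.
Qed.

Lemma R0_bracket_linearr (K : fieldType) (n : nat) (x : R0 K n) :
  linear (R0_bracket x).
Proof.
move=> a u v; rewrite /R0_bracket scaler_sumr -big_split /=.
apply: eq_bigr => i _; rewrite scaler_sumr -big_split /=.
apply: eq_bigr => j _.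
by rewrite !mxE mulrDr scalerDl scalerA mulrCA.
Qed.

Lemma R0_bracket_basis (K : fieldType) (n : nat) (i j : 'I_n.+1) :
  R0_bracket (R0_basis K i) (R0_basis K j) = R0_table K i j.
Proof.
rewrite /R0_bracket (bigD1 i) //= (bigD1 j) //= !mxE !eqxx mulr1 scale1r.
rewrite big1 ?addr0 => [|k nkj]; last by rewrite !mxE (negPf nkj) andbF mulr0 scale0r.
rewrite big1 ?addr0 // => l nli; apply: big1 => k _.
by rewrite !mxE (negPf nli) andbF mul0r scale0r.
Qed.

Lemma R0_bracketE (K : fieldType) (n : nat) (x y : R0 K n) (k : 'I_n.+1) :
  R0_bracket x y 0 k =
    (if (0 < k)%N then x 0 (inord k.-1) * y 0 (inord 1) else 0)
    - k%:R * x 0 k * y 0 0.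
Proof.
case: n => [|n] in x y k *.
  rewrite (ord1 k) ltnn !mul0r subr0 /R0_bracket !big_ord1 /R0_table /=.
  by rewrite oppr0 scale0r scaler0 mxE.
rewrite /R0_bracket summxE.
transitivity (\sum_(i < n.+2)
   ((k == i.+1 :> nat)%:R * (x 0 i * y 0 (inord 1))
     - (k == i)%:R * (i%:R * x 0 i * y 0 0))).
  apply: eq_bigr => i _; rewrite summxE.
  rewrite (bigD1 (inord 1)) //= (bigD1 ord0) /=; last first.
    by rewrite -(inj_eq val_inj) /= inordK.
  rewrite big1 ?addr0 => [|j /andP[j1 j0]]; last first.
    move: j1 j0; rewrite -!(inj_eq val_inj) /= inordK // => j1 j0.
    by rewrite /R0_table (negPf j1) (negPf j0) scaler0 mxE.
  rewrite /R0_table /= inordK //=; congr (_ + _); last first.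
    by rewrite !mxE eqxx /=; ring.
  case: ltnP => [lt_in|le_ni]; rewrite !mxE ?eqxx /=.
    by rewrite -(inj_eq val_inj) /= inordK // mulrC.
  rewrite mulr0; case: eqP => [ki|]; last by rewrite mul0r.
  by have := ltn_ord k; rewrite ki ltnS ltnNge le_ni.
rewrite sumrB; congr (_ - _); last first.
  rewrite (bigD1 k) //= eqxx mul1r big1 ?addr0 // => i nik.
  by rewrite eq_sym (negPf nik) mul0r.
case: ltnP => [k0|]; last first.
  rewrite leqn0 => /eqP k0; apply: big1 => i _.
  by rewrite k0 mul0r.
have vk : (inord k.-1 : 'I_n.+2) = k.-1 :> nat.
  by rewrite inordK // (leq_ltn_trans (leq_pred _)).
rewrite (bigD1 (inord k.-1)) //= vk prednK // eqxx mul1r big1 ?addr0 // => i.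
rewrite -(inj_eq val_inj) /= vk => nik; case: eqP => [ki|]; last by rewrite mul0r.
by rewrite ki eqxx in nik.
Qed.

Lemma R0_bracket_leibniz (K : fieldType) (n : nat) (x y z : R0 K n) :
  R0_bracket (R0_bracket x y) z
  = R0_bracket (R0_bracket x z) y + R0_bracket x (R0_bracket y z).
Proof.
apply/rowP => k; rewrite [RHS]mxE !R0_bracketE /=.
case: ltnP => [k0|]; last by rewrite leqn0 => /eqP ->; ring.
have n0 : (0 < n)%N by rewrite -ltnS (leq_ltn_trans k0).
have vk : (inord k.-1 : 'I_n.+1) = k.-1 :> nat.
  by rewrite inordK // (leq_ltn_trans (leq_pred _)).
have v0 : inord (1.-1) = 0 :> 'I_n.+1 by apply: val_inj; rewrite /= inordK.
rewrite vk inordK //= v0.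
have -> : k%:R = k.-1%:R + 1 :> K by rewrite -[in LHS](prednK k0) -natr1.
by case: ltnP => _; ring.
Qed.

HB.instance Definition _ (K : fieldType) (n : nat) :=
  isLeibniz.Build K (R0 K n) (@R0_bracket_linearl K n) (@R0_bracket_linearr K n)
    (@R0_bracket_leibniz K n).

(* Main.v *)
(** The vectors [x] with [x_0 = 1] and [[x,x] = 0] are exactly the points
    [E t = \sum_i t^i / i! e_i] of an exponential curve.  An automorphism fixes
    the coordinate [x_0] and preserves [[x,x] = 0], both of which are pointwise
    conditions, so a local automorphism [Phi] maps the curve to itself:
    [Phi (E t) = E (s t)].  Moreover [s t], the coordinate of index 1 of
    [Phi (E t)], is an affine function [a + b t].  Comparing coefficients of the
    polynomial identities [(Phi (E t))_k = (a + b t)^k / k!] determines the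
    matrix of [Phi], which turns out to be that of an automorphism. *)
Require Import Defs.
From HB Require Import structures.
From mathcomp Require Import all_boot all_order all_algebra.
From mathcomp Require Import ring.

Import GRing.Theory.
Local Open Scope ring_scope.

(** * Polynomial identities and finite-dimensional linear algebra *)

(** In characteristic zero the naturals are distinct in [K], so [p - q] has as many distinct roots
    as its size, hence more than its degree. *)
Lemma poly_eq_on_nat (K : fieldType) (charK : [pchar K] =i pred0)
    (p q : {poly K}) :
  (forall m : nat, p.[m%:R] = q.[m%:R]) -> p = q.
Proof.
move=> pq; apply/eqP; rewrite -subr_eq0; apply/eqP.
apply: (@roots_geq_poly_eq0 _ _ [seq i%:R | i <- iota 0 (size (p - q))]).
- by apply/allP => _ /mapP[i _ ->]; rewrite rootE !hornerE pq subrr.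
- rewrite map_inj_in_uniq ?iota_uniq // => i j _ _ /eqP.
  wlog le_ij : i j / (i <= j)%N => [wl|].
    by case: (leqP i j) => [/wl//|/ltnW/wl h]; rewrite eq_sym => /h.
  rewrite eq_sym -subr_eq0 -natrB // (proj1 (pcharf0P _) charK) subn_eq0 => ji.
  by apply/eqP; rewrite eqn_leq le_ij.
- by rewrite size_map size_iota.
Qed.

Lemma linear_zero (K : fieldType) (V : lmodType K) (f : V -> V) :
  linear f -> f 0 = 0.
Proof.
by move=> /(_ (-1) 0 0); rewrite scaler0 addr0 scaleN1r addNr.
Qed.

Lemma linear_R0E (K : fieldType) (n : nat) (f : R0 K n -> R0 K n)
    (x : R0 K n) (k : 'I_n.+1) :
  linear f -> f x 0 k = \sum_i x 0 i * f (R0_basis K i) 0 k.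
Proof.
move=> lin_f.
pose F : {linear R0 K n -> R0 K n} :=
  HB.pack f (GRing.isLinear.Build K (R0 K n) (R0 K n) *:%R f lin_f).
rewrite -[f]/(F : _ -> _) [in LHS](row_sum_delta x).
rewrite raddf_sum summxE; apply: eq_bigr => i _.
have /rowP/(_ k) E := linearZ_LR F (x 0 i) (R0_basis K i).
by rewrite [LHS]E mxE.
Qed.

Lemma linear_inj_bij (K : fieldType) (n : nat) (f : R0 K n -> R0 K n) :
  linear f -> (forall x, f x = 0 -> x = 0) -> bijective f.
Proof.
move=> lin_f inj_f.
pose A : 'M[K]_n.+1 := \matrix_(i, j) f (R0_basis K i) 0 j.
have fE (x : R0 K n) : f x = x *m A.
  apply/rowP => k; rewrite linear_R0E // mxE.
  by apply: eq_bigr => i _; rewrite mxE.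
have uA : A \in unitmx.
  rewrite -row_free_unit -kermx_eq0; apply/eqP/row_matrixP => i.
  by rewrite row0; apply: inj_f; rewrite fE -row_mul mulmx_ker row0.
exists (fun x : R0 K n => x *m invmx A : R0 K n) => x.
  by rewrite fE mulmxK.
by rewrite fE mulmxKV.
Qed.

(** * Coordinates 0 and 1 under a genuine automorphism *)

Section Coordinates.

Context {K : fieldType} {n : nat}.
Hypothesis n_ge1 : (1 <= n)%N.

Local Notation e i := (R0_basis K (inord i : 'I_n.+1)).
Local Notation i1 := (inord 1 : 'I_n.+1).

Lemma R0_bracket_coord0 (x y : R0 K n) : bracket x y 0 0 = 0.
Proof. by rewrite [LHS]R0_bracketE /=; ring. Qed.

Lemma R0_bracket_coordS (x y : R0 K n) (k : nat) : (k < n)%N ->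
  bracket x y 0 (inord k.+1)
  = x 0 (inord k) * y 0 i1 - k.+1%:R * x 0 (inord k.+1) * y 0 0.
Proof. by move=> lt_kn; rewrite [LHS]R0_bracketE inordK. Qed.

Lemma R0_basisS (k : nat) : (k < n)%N -> e k.+1 = bracket (e k) (e 1).
Proof.
move=> lt_kn; rewrite [RHS]R0_bracket_basis /R0_table !inordK ?lt_kn //.
by rewrite ltnS ltnW.
Qed.

Lemma automorphism_basis_coord0 (phi : R0 K n -> R0 K n) (k : nat) :
  automorphism phi -> (k < n)%N -> phi (e k.+1) 0 0 = 0.
Proof.
by move=> [_ _ phiM] ltkn; rewrite R0_basisS // phiM R0_bracket_coord0.
Qed.

(** Coordinate 1 of [[u, v]] is [u_0 v_1 - u_1 v_0], and here both factors, [phi e_(k+1)] and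
    [phi e_1], have coordinate 0 equal to zero. *)
Lemma automorphism_basis_coord1 (phi : R0 K n -> R0 K n) (k : nat) :
  automorphism phi -> (k.+1 < n)%N -> phi (e k.+2) 0 i1 = 0.
Proof.
move=> aut_phi ltkn; have [_ _ phiM] := aut_phi.
rewrite R0_basisS // phiM R0_bracket_coordS //.
have -> : (inord 0 : 'I_n.+1) = 0 by apply: val_inj; rewrite /= inordK.
by rewrite !automorphism_basis_coord0 // ?(ltnW ltkn) //; ring.
Qed.

(** Only [e_0] contributes to coordinate 0. Since [phi e_1 = [phi e_0, phi e_1]] and
    [(phi e_1)_0 = 0], coordinate 1 gives [(phi e_1)_1 = (phi e_0)_0 (phi e_1)_1]; this can be
    cancelled once [(phi e_1)_1] is nonzero. *)
Lemma automorphism_coord0 (phi : R0 K n -> R0 K n) (x : R0 K n) :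
  automorphism phi -> phi x 0 0 = x 0 0.
Proof.
move=> aut_phi; have [lin_phi bij_phi phiM] := aut_phi.
rewrite linear_R0E // big_ord_recl big1 => [|i _]; last first.
  rewrite (_ : lift _ _ = inord i.+1) ?automorphism_basis_coord0 ?mulr0 //.
  by apply: val_inj; rewrite /= inordK ?ltnS.
rewrite addr0; suff -> : phi (R0_basis K 0) 0 0 = 1 by rewrite mulr1.
have v0 : (inord 0 : 'I_n.+1) = 0 by apply: val_inj; rewrite /= inordK.
have b0 := automorphism_basis_coord0 _ _ aut_phi n_ge1.
have phi_e1 : phi (e 1) = bracket (phi (e 0)) (phi (e 1)).
  by rewrite -phiM -R0_basisS.
have b1 : phi (e 1) 0 i1 != 0.
  (* If coordinates 0 and 1 of [phi e_1] both vanish, right multiplication by it is zero, so [phi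
     e_1 = [phi e_0, phi e_1] = 0], against injectivity. *)
  apply/negP => /eqP b1.
  have phi_e1_0 : phi (e 1) = 0.
    apply/rowP => k; rewrite [RHS]mxE.
    case: (posnP k) => [k0|kgt0].
      by rewrite (_ : k = 0) //; apply: val_inj.
    rewrite phi_e1 -[k]inord_val -(prednK kgt0) R0_bracket_coordS.
      by rewrite b0 b1; ring.
    by rewrite prednK // -ltnS.
  have phi0 : phi 0 = 0 by exact: linear_zero.
  have /rowP/(_ i1) : e 1 = 0.
    by apply: (bij_inj bij_phi); rewrite phi0 phi_e1_0.
  by rewrite !mxE !eqxx => /eqP; rewrite oner_eq0.
apply: (mulIf b1); rewrite mul1r [in RHS]phi_e1 R0_bracket_coordS // v0.
by rewrite b0; ring.
Qed.

End Coordinates.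

(** * The exponential curve and its image under a local automorphism *)

Section LocalAutomorphism.

Context {K : fieldType} {n : nat}.
Hypotheses (charK : [pchar K] =i pred0) (n_ge1 : (1 <= n)%N).

Local Notation e i := (R0_basis K (inord i : 'I_n.+1)).

Let natr_neq0 (m : nat) : m.+1%:R != 0 :> K.
Proof. by rewrite (proj1 (pcharf0P _) charK). Qed.

Let fact_neq0 (m : nat) : m`!%:R != 0 :> K.
Proof. by rewrite (proj1 (pcharf0P _) charK) -lt0n fact_gt0. Qed.

Definition exp_curve (t : K) : R0 K n := \row_i (t ^+ i / i`!%:R).

Lemma exp_curve_coord (t : K) (k : nat) : (k <= n)%N ->
  exp_curve t 0 (inord k) = t ^+ k / k`!%:R.
Proof. by move=> le_kn; rewrite mxE inordK. Qed.

Lemma exp_curve_isotropic (t : K) : bracket (exp_curve t) (exp_curve t) = 0.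
Proof.
apply/rowP => k; rewrite [RHS]mxE; case: (posnP k) => [k0|kgt0].
  by rewrite (_ : k = 0) ?R0_bracket_coord0 //; apply: val_inj.
have lt_kn : (k.-1 < n)%N by rewrite prednK // -ltnS.
rewrite -[k]inord_val -(prednK kgt0) R0_bracket_coordS //.
rewrite !exp_curve_coord ?(ltnW lt_kn) // mxE /= fact0 (_ : 1`! = 1)%N //.
rewrite expr0 expr1 factS natrM exprS -[_.+1%:R]nat1r; field.
by rewrite oner_eq0 fact_neq0 nat1r natr_neq0.
Qed.

(** Coordinate [k + 1] of [[x, x] = 0] is the recurrence [(k + 1) x_(k+1) = x_k x_1]. *)
Lemma isotropic_exp_curve (x : R0 K n) (k : nat) :
    x 0 0 = 1 -> bracket x x = 0 -> (k <= n)%N ->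
  x 0 (inord k) = x 0 (inord 1) ^+ k / k`!%:R.
Proof.
move=> x0 xx; elim: k => [|k IHk] lt_kn.
  rewrite (_ : inord 0 = 0) ?x0 ?expr0 ?fact0 ?divr1 //.
  by apply: val_inj; rewrite /= inordK.
have := R0_bracket_coordS x x _ lt_kn.
rewrite xx mxE x0 mulr1 IHk ?(ltnW lt_kn) // => /esym/eqP.
rewrite subr_eq0 => /eqP E; apply: (mulfI (natr_neq0 k)); rewrite -E.
rewrite factS natrM exprSr; field.
by rewrite fact_neq0 nat1r natr_neq0.
Qed.

Context (Phi : R0 K n -> R0 K n).
Hypothesis loc_Phi : local_automorphism Phi.

Let a := Phi (e 0) 0 (inord 1).
Let b := Phi (e 1) 0 (inord 1).

(* The coordinates of [Phi (exp_curve t)], as polynomials in [t]. *)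
Let P (k : nat) : {poly K} :=
  \poly_(i < n.+1) (Phi (e i) 0 (inord k) / i`!%:R).

Lemma horner_P (t : K) (k : nat) :
  (P k).[t] = Phi (exp_curve t) 0 (inord k).
Proof.
have [lin_Phi _] := loc_Phi.
rewrite [RHS]linear_R0E // horner_poly; apply: eq_bigr => i _.
by rewrite mxE inord_val [LHS]mulrC mulrA mulrAC.
Qed.

Lemma local_automorphism_coord0 (x : R0 K n) : Phi x 0 0 = x 0 0.
Proof.
by have [_ /(_ x)[phi aut_phi ->]] := loc_Phi; apply: automorphism_coord0.
Qed.

Lemma local_automorphism_isotropic (x : R0 K n) :
  bracket x x = 0 -> bracket (Phi x) (Phi x) = 0.
Proof.
move=> xx; have [_ /(_ x)[phi [lin_phi _ phiM] ->]] := loc_Phi.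
by rewrite -phiM xx; apply: linear_zero.
Qed.

(** The automorphism agreeing with [Phi] at [e_i] varies with [i], but for [i >= 2] each of them
    gives [e_i] an image with zero coordinate 1. *)
Lemma local_automorphism_coord1 (x : R0 K n) :
  Phi x 0 (inord 1) = a * x 0 0 + b * x 0 (inord 1).
Proof.
have [lin_Phi Phi_loc] := loc_Phi.
rewrite linear_R0E //; transitivity (\sum_(i < n.+1)
    (if i == 0 then a * x 0 0 else
     if i == inord 1 then b * x 0 (inord 1) else 0)).
  apply: eq_bigr => i _; case: eqP => [->|/eqP i0].
    rewrite mulrC; congr (Phi (R0_basis K _) _ _ * _).
    by apply: val_inj; rewrite /= inordK.
  case: eqP => [->|/eqP i1]; first by rewrite mulrC.
  move: i0 i1; rewrite -!(inj_eq val_inj) /= inordK // => i0 i1.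
  case: i i0 i1 => [[|[|i]]] //= lt_i _ _.
  have -> : Ordinal lt_i = inord i.+2 by apply: val_inj; rewrite /= inordK.
  have [phi aut_phi ->] := Phi_loc (e i.+2).
  by rewrite automorphism_basis_coord1 // mulr0.
rewrite (bigD1 0) //= (bigD1 (inord 1)) /=; last first.
  by rewrite -(inj_eq val_inj) /= inordK.
rewrite eqxx -(inj_eq val_inj) /= inordK //= big1 ?addr0 // => i.
by case/andP => /negPf-> /negPf->.
Qed.

Lemma P_closed (k : nat) : (k <= n)%N ->
  P k = (k`!%:R)^-1 *: (a%:P + b *: 'X) ^+ k.
Proof.
move=> le_kn; apply: poly_eq_on_nat => // m.
rewrite horner_P isotropic_exp_curve //.
- rewrite local_automorphism_coord1 exp_curve_coord // mxE !hornerE.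
  by rewrite expr0 expr1 /= !divr1 !mulr1 [LHS]mulrC.
- by rewrite local_automorphism_coord0 mxE expr0 fact0 divr1.
by apply/local_automorphism_isotropic/exp_curve_isotropic.
Qed.

Lemma P_deriv (k : nat) : (k < n)%N -> (P k.+1)^`() = b *: P k.
Proof.
move=> lt_kn; rewrite !P_closed ?(ltnW lt_kn) // derivZ.
set q : {poly K} := _ + _.
have -> : (q ^+ k.+1)^`() = k.+1%:R *: (b *: q ^+ k).
  rewrite deriv_exp derivD derivC add0r derivZ derivX alg_polyC.
  by rewrite mul_polyC scaler_nat.
rewrite !scalerA factS natrM -[k.+1%:R]nat1r; congr (_ *: _); field.
by rewrite fact_neq0 nat1r natr_neq0.
Qed.

(** With [q = a + b X], [(k + 1) P_(k+1) = q P_k], and the part [b X P_k] is [X] times the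
    derivative of [P_(k+1)]. *)
Lemma P_euler (k : nat) : (k < n)%N ->
  k.+1%:R *: P k.+1 = a *: P k + 'X * (P k.+1)^`().
Proof.
move=> lt_kn; rewrite P_deriv // !P_closed ?(ltnW lt_kn) //.
rewrite exprS scalerA mulrDl mul_polyC -scalerAl.
rewrite -!scalerAr scalerDr !scalerA factS natrM invfM.
rewrite [k.+1%:R * _]mulrA divff // mul1r; congr (_ *: _ + _ *: _).
  by rewrite mulrC.
by rewrite mulrC.
Qed.

(** * Matrix entries of [Phi], and multiplicativity *)

(** This is the coefficient of [X^i] in [P_deriv], with the factorials cleared. *)
Lemma matrix_shift (i k : nat) : (i < n)%N -> (k < n)%N ->
  Phi (e i.+1) 0 (inord k.+1) = b * Phi (e i) 0 (inord k).
Proof.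
move=> lt_in lt_kn; have /polyP/(_ i) := P_deriv _ lt_kn.
rewrite coef_deriv coefZ !coef_poly !ltnS lt_in (ltnW lt_in) factS natrM => E.
apply: (mulIf (invr_neq0 (fact_neq0 i))); rewrite -[RHS]mulrA -E.
rewrite -[_ *+ i.+1]mulr_natr -[i.+1%:R]nat1r; field.
by rewrite fact_neq0 nat1r natr_neq0.
Qed.

(** The derivative of [P_(k+1)], of degree below [n], has no [X^n] term. *)
Lemma matrix_last (k : nat) : (k < n)%N ->
  b * Phi (e n) 0 (inord k) = 0.
Proof.
move=> lt_kn; have /polyP/(_ n) := P_deriv _ lt_kn.
rewrite coef_deriv coefZ !coef_poly !ltnS ltnn leqnn mul0rn mulrA.
by move/esym/eqP; rewrite mulf_eq0 invr_eq0 (negPf (fact_neq0 n)) orbF => /eqP.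
Qed.

(** This is the coefficient of [X^i] in [P_euler]; the operator [X d/dX] produces the factor [i]. *)
Lemma matrix_weight (i k : nat) : (i <= n)%N -> (k < n)%N ->
  k.+1%:R * Phi (e i) 0 (inord k.+1)
  = a * Phi (e i) 0 (inord k) + i%:R * Phi (e i) 0 (inord k.+1).
Proof.
move=> le_in lt_kn; have /polyP/(_ i) := P_euler _ lt_kn.
rewrite coefD coefXM coef_deriv !coefZ !coef_poly !ltnS le_in => E.
apply: (mulIf (invr_neq0 (fact_neq0 i))); rewrite -[LHS]mulrA E.
case: i le_in {E} => [|i] le_in /=; first by rewrite mul0r !addr0 mulrA.
by rewrite le_in -[(_ / _) *+ _]mulr_natl mulrDl !mulrA.
Qed.

Lemma local_automorphism_bracket (x y : R0 K n) :
  Phi (bracket x y) = bracket (Phi x) (Phi y).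
Proof.
have [lin_Phi _] := loc_Phi.
apply/rowP => k; case: (posnP k) => [k0|kgt0].
  have -> : k = 0 by apply: val_inj.
  by rewrite local_automorphism_coord0 !R0_bracket_coord0.
have lt_kn : (k.-1 < n)%N by rewrite prednK // -ltnS.
rewrite -[k]inord_val -(prednK kgt0); move: k.-1 lt_kn => {kgt0} k lt_kn.
rewrite R0_bracket_coordS // local_automorphism_coord1.
rewrite local_automorphism_coord0.
have PhiE z j :
    Phi z 0 j = \sum_(i < n.+1) z 0 (inord i) * Phi (e i) 0 j.
  by rewrite linear_R0E //; apply: eq_bigr => i _; rewrite inord_val.
(* This is [Phi [x, e_1]] at coordinate [k + 1]. The top coordinate [x_n] is lost on the left, and
   [matrix_last] removes it on the right. *)
have shift : \sum_(i < n.+1) (if (0 < i)%N then x 0 (inord i.-1) else 0)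
    * Phi (e i) 0 (inord k.+1) = b * Phi x 0 (inord k).
  rewrite big_ord_recl mul0r add0r PhiE big_ord_recr /= mulrDr.
  rewrite mulrCA matrix_last // mulr0 addr0 mulr_sumr.
  by apply: eq_bigr => i _; rewrite matrix_shift // mulrCA.
(* This is [- Phi [x, e_0]] at coordinate [k + 1]. *)
have weight : \sum_(i < n.+1) i%:R * x 0 (inord i)
    * Phi (e i) 0 (inord k.+1)
    = k.+1%:R * Phi x 0 (inord k.+1) - a * Phi x 0 (inord k).
  rewrite !PhiE !mulr_sumr -sumrB; apply: eq_bigr => i _.
  rewrite [X in X - _]mulrCA matrix_weight //; first ring.
  by rewrite -ltnS.
(* A bracket depends on its right factor only through coordinates 0 and 1, so grouping by [y_1] and
   [y_0] leaves exactly [shift] and [weight]. *)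
transitivity (y 0 (inord 1) * (b * Phi x 0 (inord k)) - y 0 0 *
    (k.+1%:R * Phi x 0 (inord k.+1) - a * Phi x 0 (inord k))); last by ring.
rewrite -shift -weight PhiE !mulr_sumr -sumrB; apply: eq_bigr => i _.
rewrite inord_val [bracket x y 0 i]R0_bracketE.
by case: ltnP => _; ring.
Qed.

Lemma local_automorphism_inj (x : R0 K n) : Phi x = 0 -> x = 0.
Proof.
have [_ /(_ x)[phi [lin_phi bij_phi _] ->]] := loc_Phi => phix.
apply: (bij_inj bij_phi); rewrite phix.
by rewrite linear_zero.
Qed.

End LocalAutomorphism.

Theorem theorem3p1 (K : fieldType) (charK : [pchar K] =i pred0)
    (n : nat) (n_ge1 : (1 <= n)%N) (Phi : R0 K n -> R0 K n) :
  local_automorphism Phi -> automorphism Phi.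
Proof.
move=> loc_Phi; have [lin_Phi _] := loc_Phi; split=> //.
  by apply: linear_inj_bij => // x; apply: local_automorphism_inj.
exact: local_automorphism_bracket.
Qed.
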